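(* Let $(X,(\cdot,\cdot|\cdot))$ be a $2$-inner product space over $\mathbb{K}$ ($\mathbb{K}=\mathbb{R}$ or $\mathbb{C}$), let $x,y,z\in X$ and $a,A\in\mathbb{K}$ be such that $$\operatorname{Re}\,(Ay-x,\,x-ay\,|\,z)\ge 0,$$ or, equivalently, $$\left\Vert x-\tfrac{a+A}{2}\,y\,\middle|\,z\right\Vert\le \tfrac12|A-a|\,\Vert y|z\Vert .$$ Then $$0\le \Vert x|z\Vert^2\Vert y|z\Vert^2-|(x,y|z)|^2\le \frac14|A-a|^2\Vert y|z\Vert^4-\operatorname{Re}\,(Ay-x,\,x-ay\,|\,z)\,\Vert y|z\Vert^2\ \left(\le \frac14|A-a|^2\Vert y|z\Vert^4\right).$$ The constant $\frac14$ in the second inequality is sharp: for every real $C<\frac14$ there exist a $2$-inner product space over $\mathbb{K}$, vectors $x,y,z$ in it and scalars $a,A\in\mathbb{K}$ satisfying $\operatorname{Re}\,(Ay-x,\,x-ay\,|\,z)\ge 0$ for which $$\Vert x|z\Vert^2\Vert y|z\Vert^2-|(x,y|z)|^2> C|A-a|^2\Vert y|z\Vert^4-\operatorname{Re}\,(Ay-x,\,x-ay\,|\,z)\,\Vert y|z\Vert^2 .$$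
   Context: Let $X$ be a linear space of dimension greater than $1$ over $\mathbb{K}$, where $\mathbb{K}=\mathbb{R}$ or $\mathbb{K}=\mathbb{C}$. A $2$-inner product on $X$ is a function $(\cdot,\cdot|\cdot):X\times X\times X\to\mathbb{K}$ such that for all $x,x',y,z\in X$ and $\alpha\in\mathbb{K}$: (1) $(x,x|z)\ge 0$, and $(x,x|z)=0$ if and only if $x$ and $z$ are linearly dependent; (2) $(x,x|z)=(z,z|x)$; (3) $(y,x|z)=\overline{(x,y|z)}$; (4) $(\alpha x,y|z)=\alpha(x,y|z)$; (5) $(x+x',y|z)=(x,y|z)+(x',y|z)$. Then $(X,(\cdot,\cdot|\cdot))$ is called a $2$-inner product space. The associated $2$-norm is $\Vert x|z\Vert=\sqrt{(x,x|z)}$. *)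

(* Defs.v *)
From HB Require Import structures.
From mathcomp Require Import all_boot all_order all_algebra.
From mathcomp Require Import reals complex.

Set Implicit Arguments.
Unset Strict Implicit.
Unset Printing Implicit Defensive.

Import Order.TTheory GRing.Theory Num.Theory.
Local Open Scope ring_scope.

Inductive scalar_kind := RealScalars | ComplexScalars.

Definition scalars (R : realType) (k : scalar_kind) : numFieldType :=
  match k with RealScalars => R | ComplexScalars => R[i] end.

Definition conjK (R : realType) (k : scalar_kind) : scalars R k -> scalars R k :=
  match k with
  | RealScalars => fun c : R => c
  | ComplexScalars => fun c : R[i] => Num.conj c
  end.

Definition reK (R : realType) (k : scalar_kind) : scalars R k -> R :=
  match k with
  | RealScalars => fun c : R => c
  | ComplexScalars => fun c : R[i] => complex.Re c
  end.

(* The library modulus `|c| is an element of the scalar field itself, real when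
   that field is R[i]; taking its real part only moves it to R. *)
Definition absK (R : realType) (k : scalar_kind) (c : scalars R k) : R :=
  reK `|c|.

Definition lin_dep (K : fieldType) (X : lmodType K) (u v : X) : Prop :=
  exists a b : K, ((a != 0) || (b != 0)) /\ a *: u + b *: v = 0.

(* [ip x y z] stands for (x, y | z). In [tip_ge0] the order is that of the
   scalar field: over R[i], 0 <= c means that c is real and nonnegative. *)
Record two_inner_product_space (R : realType) (k : scalar_kind)
    (X : lmodType (scalars R k)) (ip : X -> X -> X -> scalars R k) : Prop := {
  tip_dim_gt1 : exists u v : X, ~ lin_dep u v;
  tip_ge0 : forall x z, 0 <= ip x x z;
  tip_eq0 : forall x z, ip x x z = 0 <-> lin_dep x z;
  tip_swap : forall x z, ip x x z = ip z z x;
  tip_conj : forall x y z, ip y x z = conjK (ip x y z);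
  tip_scale : forall (c : scalars R k) x y z, ip (c *: x) y z = c * ip x y z;
  tip_add : forall x x' y z, ip (x + x') y z = ip x y z + ip x' y z
}.

Definition two_norm (R : realType) (k : scalar_kind) (X : lmodType (scalars R k))
    (ip : X -> X -> X -> scalars R k) (x z : X) : R :=
  Num.sqrt (reK (ip x x z)).

(* Main.v *)
(** Put m = (a + A)/2, d = (A - a)/2 and u = x - m y.  Then
    Re (Ay - x, x - ay | z) = |d|^2 ||y|z||^2 - ||u|z||^2, which gives the
    equivalence of the two hypotheses; and the Gram determinant of x, y is that
    of u, y, hence at most ||u|z||^2 ||y|z||^2.  Sharpness: on the plane
    with (x, y | z) = det(x, z) * conj det(y, z), take x = 0, a = -1, A = 1,
    where the Gram determinant vanishes and the bound with C in place of 1/4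
    is 4C - 1 < 0. *)
Require Import Defs.
From HB Require Import structures.
From mathcomp Require Import all_boot all_order all_algebra.
From mathcomp Require Import reals complex ring lra.

Set Implicit Arguments.
Unset Strict Implicit.
Unset Printing Implicit Defensive.

Import Order.TTheory GRing.Theory Num.Theory.
Local Open Scope ring_scope.

(** * Conjugation, real part and modulus, uniformly over the real and complex scalars *)

Section Scalars.
Variables (R : realType) (k : scalar_kind).
Implicit Types c d : scalars R k.

Lemma conjKD c d : conjK (c + d) = conjK c + conjK d.
Proof. by case: k c d => //= c d; rewrite rmorphD. Qed.

Lemma conjKM c d : conjK (c * d) = conjK c * conjK d.
Proof. by case: k c d => //= c d; rewrite rmorphM. Qed.

Lemma conjKN c : conjK (- c) = - conjK c.
Proof. by case: k c => //= c; rewrite rmorphN. Qed.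

Lemma conjKK c : conjK (conjK c) = c.
Proof. by case: k c => //= c; rewrite conjCK. Qed.

Lemma normK2 c : `|c| ^+ 2 = c * conjK c.
Proof.
case: k c => /= c; last by rewrite normCK.
by rewrite real_normK ?num_real // expr2.
Qed.

Lemma conjK_ge0 c : 0 <= c -> conjK c = c.
Proof. by case: k c => //= c c0; apply/CrealP/ger0_real. Qed.

Lemma reKD c d : reK (c + d) = reK c + reK d.
Proof. by case: k c d => //= -[a b] [a' b']. Qed.

Lemma reKN c : reK (- c) = - reK c.
Proof. by case: k c => //= -[a b]. Qed.

Lemma reKB c d : reK (c - d) = reK c - reK d.
Proof. by rewrite reKD reKN. Qed.

Lemma reK_conj c : reK (conjK c) = reK c.
Proof. by case: k c => //= -[a b]. Qed.

Lemma reK0 : reK (0 : scalars R k) = 0.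
Proof. by case: k. Qed.

Lemma reK1 : reK (1 : scalars R k) = 1.
Proof. by case: k. Qed.

Lemma reK_ge0 c : 0 <= c -> 0 <= reK c.
Proof. by case: k c => //= -[a b]; rewrite lecE /= => /andP[]. Qed.

(** In [R[i]] a nonnegative [c] has zero imaginary part. This lets identities between real
    quantities be lifted to the scalar field, where [ring] applies. *)
Lemma reKM_ge0 c d : 0 <= c -> reK (c * d) = reK c * reK d.
Proof.
case: k c d => //= -[a b] [a' b']; rewrite lecE /= => /andP[/eqP -> _].
by rewrite mul0r subr0.
Qed.

Lemma absK_ge0 c : 0 <= absK c.
Proof. exact/reK_ge0/normr_ge0. Qed.

Lemma absK_sqr c : absK c ^+ 2 = reK (c * conjK c).
Proof. by rewrite -normK2 expr2 reKM_ge0 // expr2. Qed.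

Lemma absK_half c : absK (c / 2) = 1 / 2 * absK c.
Proof.
rewrite /absK normrM mulrC reKM_ge0 //; congr (_ * _).
rewrite ger0_norm ?invr_ge0 //.
(* The real part of 1/2 is read off from 2 * 2^-1 = 1. *)
have := reKM_ge0 (2^-1 : scalars R k) (ler0n (scalars R k) 2).
rewrite divff ?pnatr_eq0 // (reKD 1 1) !reK1 => e; lra.
Qed.

End Scalars.

(** * Gram determinants and the Cauchy-Schwarz inequality *)

Section TwoInnerProduct.
Variables (R : realType) (k : scalar_kind) (X : lmodType (scalars R k)).
Variable ip : X -> X -> X -> scalars R k.
Hypothesis ipP : two_inner_product_space ip.
Implicit Types (x y z u v : X) (c d a A : scalars R k).

Lemma ipNl x y z : ip (- x) y z = - ip x y z.
Proof. by rewrite -scaleN1r (tip_scale ipP) mulN1r. Qed.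

Lemma ipDr x y y' z : ip x (y + y') z = ip x y z + ip x y' z.
Proof.
by rewrite (tip_conj ipP) (tip_add ipP) conjKD -!(tip_conj ipP).
Qed.

Lemma ipZr c x y z : ip x (c *: y) z = conjK c * ip x y z.
Proof. by rewrite (tip_conj ipP) (tip_scale ipP) conjKM -(tip_conj ipP). Qed.

Lemma ipNr x y z : ip x (- y) z = - ip x y z.
Proof. by rewrite (tip_conj ipP) ipNl conjKN -(tip_conj ipP). Qed.

Definition ip_linear := (ipNl, ipNr, ipZr, ipDr, tip_add ipP, tip_scale ipP).

Lemma two_norm_sqr x z : two_norm ip x z ^+ 2 = reK (ip x x z).
Proof. by rewrite sqr_sqrtr // reK_ge0 // (tip_ge0 ipP). Qed.

(** Replacing x by x - c y is a unimodular change of the pair (x, y), so it preserves the Gram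
    determinant. *)
Lemma gram_shear x y z c :
  two_norm ip (x - c *: y) z ^+ 2 * two_norm ip y z ^+ 2
    - absK (ip (x - c *: y) y z) ^+ 2
  = two_norm ip x z ^+ 2 * two_norm ip y z ^+ 2 - absK (ip x y z) ^+ 2.
Proof.
rewrite !two_norm_sqr !absK_sqr -!reKM_ge0 ?(tip_ge0 ipP) // -!reKB.
congr reK; rewrite !ip_linear conjKD conjKN conjKM.
rewrite (conjK_ge0 (tip_ge0 ipP y z)) (tip_conj ipP x y z); ring.
Qed.

Lemma two_cauchy_schwarz x y z :
  absK (ip x y z) ^+ 2 <= two_norm ip x z ^+ 2 * two_norm ip y z ^+ 2.
Proof.
have [q0|q0] := eqVneq (ip y y z) 0.
  suff -> : ip x y z = 0.
    by rewrite /absK normr0 reK0 expr0n mulr_ge0 ?sqr_ge0.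
  apply/eqP/negPn/negP => p0.
  pose p := ip x y z.
  have pp : 0 < p * conjK p by rewrite -normK2 exprn_gt0 ?normr_gt0.
  (* (x - t p y, x - t p y | z) is affine in real t since (y, y | z) = 0, hence
     takes negative values unless p = 0; this t gives - (x, x | z) - 2. *)
  pose t := (ip x x z + 1) / (p * conjK p).
  have n0 := tip_ge0 ipP x z.
  have t0 : 0 <= t by rewrite divr_ge0 ?addr_ge0 // ltW.
  have := tip_ge0 ipP (x - (t * p) *: y) z.
  rewrite !ip_linear q0 conjKM (conjK_ge0 t0) (tip_conj ipP x y z) -/p.
  rewrite [leRHS](_ : _ = - (ip x x z + 2)).
    by rewrite oppr_ge0 lt_geF // ltr_wpDl.
  have : t * (p * conjK p) = ip x x z + 1 by rewrite divfK ?gt_eqF.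
  clearbody t p; move: (conjK p) (ip x x z) {pp n0 t0} => p' n e.
  transitivity (n - 2 * (t * (p * p'))); first by ring.
  by rewrite e; ring.
(* Shearing by the projection coefficient makes the mixed product with y vanish, so the Gram
   determinant becomes a product of two squares. *)
rewrite -subr_ge0 -(gram_shear x y z (ip x y z / ip y y z)).
rewrite !ip_linear divfK // subrr /absK normr0 reK0 expr0n subr0.
by rewrite mulr_ge0 ?sqr_ge0.
Qed.

Lemma re_ip_segment x y z a A :
  reK (ip (A *: y - x) (x - a *: y) z)
  = (1 / 2 * absK (A - a) * two_norm ip y z) ^+ 2
    - two_norm ip (x - ((a + A) / 2) *: y) z ^+ 2.
Proof.
set m := (a + A) / 2; rewrite -absK_half; set d := (A - a) / 2.
have two0 : 2 != 0 :> scalars R k by rewrite pnatr_eq0.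
have eA : A = m + d by rewrite /m /d; field.
have ea : a = m - d by rewrite /m /d; field.
set u := x - m *: y.
have -> : A *: y - x = d *: y - u.
  by rewrite /u eA scalerDl opprB addrAC addrC.
have -> : x - a *: y = u + d *: y.
  by rewrite /u ea scalerBl opprB addrA addrAC.
clearbody u; rewrite exprMn !two_norm_sqr absK_sqr mulrC.
rewrite -reKM_ge0 ?(tip_ge0 ipP) //.
rewrite !ip_linear (tip_conj ipP u y z).
rewrite mulrDr mulrN !(reKD, reKN).
(* The cross terms d (y, u | z) and conj d (u, y | z) are conjugate to each other and enter with
   opposite signs, so their real parts cancel. *)
rewrite -(reK_conj (conjK d * ip u y z)) conjKM conjKK.
rewrite (_ : conjK d * _ = ip y y z * (d * conjK d)); [lra|ring].
Qed.

End TwoInnerProduct.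

(** * The determinant model on the plane *)

Section Plane.
Variables (R : realType) (k : scalar_kind).
Let K : numFieldType := scalars R k.
Let plane : lmodType K := (K^o * K^o)%type.
Implicit Types u v z : plane.

Definition plane_det (u v : plane) : K := u.1 * v.2 - u.2 * v.1.

(** By Cauchy-Binet this is the standard 2-inner product <u, v><z, z> - <u, z><z, v> of the
    plane. *)
Definition plane_ip (u v z : plane) : K :=
  plane_det u z * conjK (plane_det v z).

Lemma plane_det_eq0 u v : plane_det u v = 0 <-> @lin_dep K plane u v.
Proof.
case: u v => [u1 u2] [v1 v2]; rewrite /plane_det /=; split=> [e|]; last first.
  case=> a [b [ab [e1 e2]]]; move: e1 e2; rewrite /= /GRing.scale /= => e1 e2.
  (* Cramer's rule: each coefficient times the determinant is a combination of the coordinates of a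
     u + b v, which vanish. *)
  have ea : a * (u1 * v2 - u2 * v1)
      = (a * u1 + b * v1) * v2 - (a * u2 + b * v2) * v1 by ring.
  have eb : b * (u1 * v2 - u2 * v1)
      = (a * u2 + b * v2) * u1 - (a * u1 + b * v1) * u2 by ring.
  rewrite e1 e2 !mul0r subr0 in ea eb.
  by case/orP: ab => n0; apply: (mulfI n0); rewrite mulr0.
have commN (p q : K) : p * q + - q * p = 0 by ring.
have det1 (p q r s : K) : p * q - r * s = 0 -> s * r + - p * q = 0.
  by move=> h; rewrite -[RHS]oppr0 -h; ring.
have det2 (p q r s : K) : p * q - r * s = 0 -> q * p + - r * s = 0.
  by move=> <-; ring.
(* When the determinant is zero, v1 u - u1 v = 0 and v2 u - u2 v = 0; one of these is a nontrivial
   relation unless u = 0. *)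
have [u10|u1n0] := eqVneq u1 0; last first.
  exists v1, (- u1); rewrite oppr_eq0 u1n0 orbT; split=> //.
  congr (_, _); [exact: commN|exact: det1 e].
have [u20|u2n0] := eqVneq u2 0; last first.
  exists v2, (- u2); rewrite oppr_eq0 u2n0 orbT; split=> //.
  congr (_, _); [exact: det2 e|exact: commN].
exists 1, 0; rewrite oner_eq0; split=> //.
by rewrite u10 u20 scale0r scale1r addr0.
Qed.

(** Since (x, x | z) = |det(x, z)|^2, the swap axiom is the antisymmetry of the determinant. *)
Lemma plane_ipP : @two_inner_product_space R k plane plane_ip.
Proof.
split=> [|x z|x z|x z|x y z|c x y z|x x' y z].
- exists (1, 0), (0, 1); rewrite -plane_det_eq0 /plane_det /= mulr1 mulr0 subr0.
  by apply/eqP; rewrite oner_eq0.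
- by rewrite /plane_ip -normK2 exprn_ge0.
- rewrite /plane_ip -normK2 -plane_det_eq0; split=> [/eqP|->].
    by rewrite expf_eq0 /= normr_eq0 => /eqP.
  by rewrite normr0 expr0n.
- rewrite /plane_ip -!normK2; congr (_ ^+ 2).
  have detN (p q r s : K) : p * q - r * s = - (s * r - q * p) by ring.
  by rewrite /plane_det -[RHS]normrN; congr (`|_|); exact: detN.
- by rewrite /plane_ip conjKM conjKK mulrC.
- rewrite /plane_ip mulrA; congr (_ * _).
  have detZ (p q r s : K) : c * p * q - c * r * s = c * (p * q - r * s) by ring.
  exact: detZ.
- rewrite /plane_ip -mulrDl; congr (_ * _).
  have detD (p p' q r r' s : K) :
    (p + p') * q - (r + r') * s = p * q - r * s + (p' * q - r' * s) by ring.
  exact: detD.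
Qed.

End Plane.

Theorem theorem2 (R : realType) (k : scalar_kind) :
  (forall (X : lmodType (scalars R k)) (ip : X -> X -> X -> scalars R k),
     two_inner_product_space ip ->
     forall (x y z : X) (a A : scalars R k),
       (0 <= reK (ip (A *: y - x) (x - a *: y) z) <->
        two_norm ip (x - ((a + A) / 2) *: y) z
          <= 1 / 2 * absK (A - a) * two_norm ip y z)
       /\
       (0 <= reK (ip (A *: y - x) (x - a *: y) z) ->
        [/\ 0 <= two_norm ip x z ^+ 2 * two_norm ip y z ^+ 2
                 - absK (ip x y z) ^+ 2,
            two_norm ip x z ^+ 2 * two_norm ip y z ^+ 2 - absK (ip x y z) ^+ 2
              <= 1 / 4 * absK (A - a) ^+ 2 * two_norm ip y z ^+ 4
                 - reK (ip (A *: y - x) (x - a *: y) z) * two_norm ip y z ^+ 2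
          & 1 / 4 * absK (A - a) ^+ 2 * two_norm ip y z ^+ 4
              - reK (ip (A *: y - x) (x - a *: y) z) * two_norm ip y z ^+ 2
              <= 1 / 4 * absK (A - a) ^+ 2 * two_norm ip y z ^+ 4]))
  /\
  (forall C : R, C < 1 / 4 ->
     exists (X : lmodType (scalars R k)) (ip : X -> X -> X -> scalars R k)
            (x y z : X) (a A : scalars R k),
       [/\ two_inner_product_space ip,
           0 <= reK (ip (A *: y - x) (x - a *: y) z)
         & C * absK (A - a) ^+ 2 * two_norm ip y z ^+ 4
             - reK (ip (A *: y - x) (x - a *: y) z) * two_norm ip y z ^+ 2
           < two_norm ip x z ^+ 2 * two_norm ip y z ^+ 2
             - absK (ip x y z) ^+ 2]).
Proof.
split=> [X ip ipP x y z a A|C C4].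
  have eE := re_ip_segment ipP x y z a A.
  have h0 : 0 <= 1 / 2 * absK (A - a) * two_norm ip y z.
    by rewrite !mulr_ge0 ?absK_ge0 ?sqrtr_ge0 ?invr_ge0.
  split.
    rewrite eE subr_ge0 ler_sqr ?nnegrE ?sqrtr_ge0 //.
  move=> E0; split.
  - by rewrite subr_ge0 two_cauchy_schwarz.
  (* With u = x - m y the upper bound equals ||u|z||^2 ||y|z||^2, so the slack is exactly |(u, y |
     z)|^2. *)
  - rewrite eE -(gram_shear ipP x y z ((a + A) / 2)).
    have := sqr_ge0 (absK (ip (x - ((a + A) / 2) *: y) y z)); lra.
  - by rewrite gerBl mulr_ge0 ?sqr_ge0.
exists ((scalars R k)^o * (scalars R k)^o)%type, (@plane_ip R k).
(* Here Ay - x = x - ay = y and ||y|z|| = 1, so the real part is 1 while |A - a| = 2. *)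
exists 0, (1, 0), (0, 1), (-1), 1.
have n1 : reK (@plane_ip R k (1, 0) (1, 0) (0, 1)) = 1.
  rewrite /plane_ip /plane_det /= mulr1 mulr0 subr0.
  by rewrite -normK2 normr1 expr1n reK1.
rewrite /two_norm n1 sqrtr1 !expr1n scale1r scaleN1r subr0 opprK add0r n1.
have -> : @plane_ip R k 0 0 (0, 1) = 0.
  by rewrite /plane_ip /plane_det /= !mul0r subr0 mul0r.
have -> : @plane_ip R k 0 (1, 0) (0, 1) = 0.
  by rewrite /plane_ip /plane_det /= !mul0r subr0 mul0r.
have -> : absK (1 - -1 : scalars R k) = 1 + 1.
  by rewrite /absK opprK ger0_norm ?addr_ge0 // reKD reK1.
rewrite /absK normr0 reK0 sqrtr0.
split=> //; [exact: plane_ipP|lra].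
Qed.
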